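(* Let $(x_n),(y_n)$ be the sequences generated by the stochastic Halpern-Mann iteration $$y_n:=(1-\alpha_n)(Tx_n+\xi_n)+\alpha_nu,\qquad x_{n+1}:=(1-\beta_n)(Uy_n+\delta_n)+\beta_ny_n .$$ Assume there is a nonnegative random variable $Y$ and $K_0\in\mathbb{N}^*$ with $\mathbb{E}[Y]\le K_0$ such that for all $n\in\mathbb{N}$, $\|Tx_n-u\|,\|Uy_n-y_n\|,\|Uu-u\|,\|Uy_n-u\|\le Y$ almost surely. Assume that $\|Uy_n-y_n\|\to0$ almost surely with rate $\psi$, and $\alpha_n\to0$ with rate $\rho$. Further, assume that $\|\xi_n\|\to0$ and $\|\delta_n\|\to0$ almost surely with rates $\phi_1$ and $\phi_2$, respectively, and that $\|x_{n+1}-x_n\|\to0$ almost surely with rate $\psi_0$. Then: (a) $\|x_n-y_n\|\to0$ almost surely with rate $\psi_1(\lambda,\varepsilon):=\max\{\psi_0(\lambda/3,\varepsilon/3),\psi(\lambda/3,\varepsilon/3),\phi_2(\lambda/3,\varepsilon/3)\}$; (b) $\|Ty_n-y_n\|\to0$ almost surely with rate $\psi_2(\lambda,\varepsilon):=\max\{\psi_1(\lambda/3,\varepsilon/3),\rho(\varepsilon\lambda/(9K_0)),\phi_1(\lambda/3,\varepsilon/3)\}$; (c) $\|Ux_n-x_n\|\to0$ almost surely with rate $\psi_3(\lambda,\varepsilon):=\max\{\psi_1(\lambda/2,\varepsilon/3),\psi(\lambda/2,\varepsilon/3)\}$; (d) $\|Tx_n-x_n\|\to0$ almost surely with rate $\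psi_4(\lambda,\varepsilon):=\max\{\psi_1(\lambda/2,\varepsilon/3),\psi_2(\lambda/2,\varepsilon/3)\}$.
   Context: $\mathbb{N}=\{0,1,2,\dots\}$, $\mathbb{N}^*=\mathbb{N}\setminus\{0\}$. $(\Omega,\mathcal{F},\mathbb{P})$ is a probability space, $(X,\|\cdot\|)$ is a separable real normed space, and an $X$-valued random variable is a measurable function $\Omega\to X$. $T,U:X\to X$ are nonexpansive ($\|Tx-Ty\|\le\|x-y\|$, $\|Ux-Uy\|\le\|x-y\|$ for all $x,y\in X$); $x_0$ (the starting point) and $u$ (the anchor) are arbitrary $X$-valued random variables; $(\xi_n),(\delta_n)$ are sequences of $X$-valued random variables; $(\alpha_n),(\beta_n)\subseteq[0,1]$ are deterministic. For nonnegative reals $(a_n)$, a rate for $a_n\to0$ is a function $\varphi:(0,\infty)\to\mathbb{N}$ with $a_n<\varepsilon$ for all $\varepsilon>0$ and all $n\ge\varphi(\varepsilon)$. For nonnegative random variables $(X_n)$, a rate for $X_n\to0$ almost surely is a function $\Phi:(0,\infty)^2\to\mathbb{N}$ with $\mathbb{P}(\exists n\ge\Phi(\lambda,\varepsilon)\,(X_n\ge\varepsilon))<\lambda$ for all $\lambda,\varepsilon>0$. *)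

(* Defs.v *)
From mathcomp Require Import all_boot all_order all_algebra.
From mathcomp Require Import all_classical all_reals all_analysis.

Set Implicit Arguments.
Unset Strict Implicit.
Unset Printing Implicit Defensive.

Import Order.TTheory GRing.Theory Num.Theory.
Import numFieldNormedType.Exports.

Local Open Scope classical_set_scope.
Local Open Scope ring_scope.

Definition separable_space (X : topologicalType) : Prop :=
  exists2 D : set X, countable D & dense D.

Definition nonexpansive (R : realType) (X : normedModType R) (T : X -> X) : Prop :=
  forall x y : X, `|T x - T y| <= `|x - y|.

(* A normed space carries no canonical measurable structure, so measurability
   is stated on its alias equipped with the Borel sigma-algebra, while the
   function itself keeps its values in the normed space. *)
Definition borel_rv (R : realType) (X : normedModType R) (d : measure_display)
    (Omega : measurableType d) (f : Omega -> X) : Prop :=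
  measurable_fun [set: Omega] (f : Omega -> g_sigma_algebraType (@open X)).

(* Rates have domain (0, oo) or (0, oo)^2: they are encoded as functions on R,
   only ever constrained at positive arguments. *)
Definition rate_to0 (R : realType) (a : nat -> R) (phi : R -> nat) : Prop :=
  forall eps : R, 0 < eps -> forall n : nat, (phi eps <= n)%N -> a n < eps.

Definition as_rate_to0 (R : realType) (d : measure_display)
    (Omega : measurableType d) (P : probability Omega R)
    (Z : nat -> Omega -> R) (Phi : R -> R -> nat) : Prop :=
  forall lambda eps : R, 0 < lambda -> 0 < eps ->
    (P [set w | exists n : nat, (Phi lambda eps <= n)%N /\ (eps <= Z n w)%R]
       < lambda%:E)%E.

(* Main.v *)
Require Import Defs.
From mathcomp Require Import all_boot all_order all_algebra.
From mathcomp Require Import all_classical all_reals all_analysis.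
From mathcomp Require Import ring lra.

Set Implicit Arguments.
Unset Strict Implicit.
Unset Printing Implicit Defensive.

Import Order.TTheory GRing.Theory Num.Theory.
Import numFieldNormedType.Exports.

Local Open Scope classical_set_scope.
Local Open Scope ring_scope.

(** All four claims are union bounds.  Pointwise,
      |x_n - y_n|  <= |x_(n+1) - x_n| + |U y_n - y_n| + |delta_n|,
      |T y_n - y_n| <= |x_n - y_n| + alpha_n |T x_n - u| + |xi_n|,
      |V x_n - x_n| <= 2 |x_n - y_n| + |V y_n - y_n|   for V nonexpansive,
    the first two because x_(n+1) - y_n = (1 - beta_n)(U y_n - y_n + delta_n)
    and T x_n - y_n = alpha_n (T x_n - u) - (1 - alpha_n) xi_n, with
    coefficients in [0, 1].  If the left-hand side reaches eps at some index
    past the thresholds of the summands, then one of the norms on the right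
    reaches eps / 3 there, so the tail event on the left is covered by two or
    three tail events, whose probabilities share lambda between them
    ([as_rate_to0_sum2], [as_rate_to0_sum3]).

    The summand alpha_n |T x_n - u| is at most alpha_n Y almost surely.  Past
    rho (eps lambda / K) it can reach eps only where Y >= K / lambda, an event
    of probability at most lambda by the Markov inequality
    ([as_weak_rate_to0_scale]).  That bound is not strict, but a union bound is
    strict as soon as one of its terms is; hence the notion of weak rate.

    Monotonicity and subadditivity of P are available for measurable events
    only, so every tail event has to be measurable.  This is where separability
    enters: over a separable space, open sets of X * X pull back to measurable
    sets along a pair of Borel maps, so Borel maps are closed under addition,
    and all the iterates are Borel ([measurable_pair_preimage],
    [borel_rvD]). *)

(** * Borel maps into a separable normed space *)

Lemma borel_rv_preimage (R : realType) (X : normedModType R)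
    (d : measure_display) (Omega : measurableType d) (f : Omega -> X)
    (O : set X) : borel_rv f -> open O -> measurable (f @^-1` O).
Proof.
move=> mf oO; rewrite -[_ @^-1` _]setTI.
by apply: mf => //; exact: sub_sigma_algebra.
Qed.

Lemma borel_rvP (R : realType) (X : normedModType R)
    (d : measure_display) (Omega : measurableType d) (f : Omega -> X) :
  (forall O : set X, open O -> measurable (f @^-1` O)) -> borel_rv f.
Proof.
move=> mf; rewrite /borel_rv.
apply: (@measurability _ _ _ (g_sigma_algebraType (@open X)) _ _ (@open X)) => //.
move=> _ [V oV <-].
by rewrite setTI; exact: mf.
Qed.

(** Indices outside the range of the injection of the dense set into nat are
    sent to [point], which leaves the range dense. *)
Lemma separable_dense_seq (T : ptopologicalType) :
  separable_space T -> exists e : nat -> T, dense (range e).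
Proof.
move=> [D /countable_injP[f injf] dD].
exists (fun n => xget point [set a | D a /\ f a = n]) => O O0 oO.
have [a [Oa Da]] := dD O O0 oO; exists a; split => //; exists (f a) => //=.
have : [set b | D b /\ f b = f a] (xget point [set b | D b /\ f b = f a]).
  by apply: (xgetPex point); exists a.
by move=> [Db fba]; apply: injf; rewrite ?inE.
Qed.

(** Products of two balls with dense centers and a common radius 1 / (k + 1)
    form a countable base of X * X, so an open O is a countable union of such
    boxes, and the preimage of a box is an intersection of two measurable
    sets. *)
Lemma measurable_pair_preimage (R : realType) (X : normedModType R)
    (d : measure_display) (Omega : measurableType d) (f g : Omega -> X)
    (O : set (X * X)) :
  separable_space X -> borel_rv f -> borel_rv g -> open O ->
  measurable [set w | O (f w, g w)].
Proof.
move=> /separable_dense_seq[e de] mf mg oO.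
pose r k : R := k.+1%:R^-1.
pose B i j k : set (X * X) := ball (e i) (r k) `*` ball (e j) (r k).
pose F (t : nat * nat * nat) : set Omega :=
  if `[< B t.1.1 t.1.2 t.2 `<=` O >] then
    f @^-1` ball (e t.1.1) (r t.2) `&` g @^-1` ball (e t.1.2) (r t.2)
  else set0.
have -> : [set w | O (f w, g w)] = \bigcup_t F t.
  apply/seteqP; split => [w /= Ofg | w [t _]]; last first.
    by rewrite /F; case: asboolP => // BO [fw gw]; exact: (BO (f w, g w)).
  have /nbhs_ballP[s /= s0 sO] := open_nbhs_nbhs (conj oO Ofg).
  have [k rks] : exists k, r k < s / 2.
    have s20 : 0 < s / 2 by rewrite divr_gt0.
    have [k _ /(_ k (leqnn k))] := near_infty_natSinv_lt (PosNum s20).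
    by exists k.
  have rk0 : 0 < r k by rewrite invr_gt0.
  have dist (a : X) : exists i, ball (e i) (r k) a.
    have [||b [ab [i _ ei]]] := de (ball a (r k)).
    - by exists a; exact: ballxx.
    - exact: ball_open.
    - by exists i; apply: ball_sym; rewrite ei.
  have [i fi] := dist (f w); have [j gj] := dist (g w).
  (* The box around (f w, g w) lies in the ball of radius s because a ball of
     radius r k has diameter at most 2 r k < s. *)
  have close c a b : ball c (r k) a -> ball c (r k) b -> ball a s b.
    move=> ca cb; apply: (@ball_split _ _ c).
      exact: (le_ball (ltW rks) (ball_sym ca)).
    exact: (le_ball (ltW rks) cb).
  exists (i, j, k) => //; rewrite /F /=; case: asboolP => // -[] [a b] [/= ia jb].
  by apply: sO; split => /=; [exact: close fi ia | exact: close gj jb].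
apply: countable_bigcupT_measurable => [|t]; first exact: countableP.
rewrite /F; case: ifP => // _.
by apply: measurableI; apply: borel_rv_preimage => //; exact: ball_open.
Qed.

Lemma borel_rv_comp2 (R : realType) (X : normedModType R)
    (d : measure_display) (Omega : measurableType d) (h : X * X -> X)
    (f g : Omega -> X) :
  separable_space X -> continuous h -> borel_rv f -> borel_rv g ->
  borel_rv (fun w => h (f w, g w)).
Proof.
move=> sX /continuousP ch mf mg; apply: borel_rvP => O oO.
exact: measurable_pair_preimage sX mf mg (ch O oO).
Qed.

Lemma borel_rv_comp (R : realType) (X : normedModType R)
    (d : measure_display) (Omega : measurableType d) (h : X -> X)
    (f : Omega -> X) :
  continuous h -> borel_rv f -> borel_rv (fun w => h (f w)).
Proof.
move=> /continuousP ch mf; apply: borel_rvP => O oO.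
exact: borel_rv_preimage mf (ch O oO).
Qed.

Lemma nonexpansive_continuous (R : realType) (X : normedModType R) (T : X -> X) :
  nonexpansive T -> continuous T.
Proof.
move=> nT a; apply/cvgrPdist_lt => e e0; near=> b.
apply: le_lt_trans (nT a b) _.
by near: b; apply/nbhs_normP; exists e.
Unshelve. all: by end_near. Qed.

Lemma borel_rvD (R : realType) (X : normedModType R)
    (d : measure_display) (Omega : measurableType d) (f g : Omega -> X) :
  separable_space X -> borel_rv f -> borel_rv g ->
  borel_rv (fun w => f w + g w).
Proof.
move=> sX.
exact: (@borel_rv_comp2 R X d Omega (fun z => z.1 + z.2) f g sX
  (@add_continuous X)).
Qed.

Lemma borel_rvZ (R : realType) (X : normedModType R)
    (d : measure_display) (Omega : measurableType d) (a : R) (f : Omega -> X) :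
  borel_rv f -> borel_rv (fun w => a *: f w).
Proof. by apply: borel_rv_comp; exact: scaler_continuous. Qed.

Lemma borel_rvB (R : realType) (X : normedModType R)
    (d : measure_display) (Omega : measurableType d) (f g : Omega -> X) :
  separable_space X -> borel_rv f -> borel_rv g ->
  borel_rv (fun w => f w - g w).
Proof.
move=> sX mf mg; apply: borel_rvD => //.
by apply: (@borel_rv_comp R X d Omega -%R) mg; exact: opp_continuous.
Qed.

(** * Tail events and their probabilities *)

Definition tail_event (R : realType) (Omega : Type) (Z : nat -> Omega -> R)
    (N : nat) (eps : R) : set Omega :=
  [set w | exists n : nat, (N <= n)%N /\ eps <= Z n w].

Lemma measurable_tail_event (R : realType) (X : normedModType R)
    (d : measure_display) (Omega : measurableType d) (z : nat -> Omega -> X)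
    (N : nat) (eps : R) :
  (forall n, borel_rv (z n)) ->
  measurable (tail_event (fun n w => `|z n w|) N eps).
Proof.
move=> mz.
have -> : tail_event (fun n w => `|z n w|) N eps =
    \bigcup_(n in [set n | (N <= n)%N]) [set w | eps <= `|z n w|].
  by apply/seteqP; split => w [n]; [case=> Nn zn | move=> Nn zn]; exists n.
apply: bigcup_measurable => n _.
have -> : [set w | eps <= `|z n w|] = ~` (z n @^-1` [set a | `|a| < eps]).
  by apply/seteqP; split => w /=; rewrite leNgt => /negP.
apply/measurableC/borel_rv_preimage => //.
have := @norm_continuous R X; move/continuousP/(_ [set t | t < eps]); apply.
exact: open_lt.
Qed.

(** Strictness of one of the two bounds survives the sum because probabilities
    are finite. *)
Lemma probability_lt_cover (R : realType) (d : measure_display)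
    (Omega : measurableType d) (P : probability Omega R) (A B C : set Omega)
    (b c : R) :
  measurable A -> measurable B -> measurable C -> A `<=` B `|` C ->
  (P B < b%:E)%E -> (P C <= c%:E)%E -> (P A < (b + c)%:E)%E.
Proof.
move=> mA mB mC ABC Bb Cc.
have mBC : measurable (B `|` C) by exact: measurableU.
apply: (@le_lt_trans _ _ (P B + P C)%E).
  apply: le_trans (measureU2 P mB mC).
  by apply: le_measure; rewrite ?inE.
by rewrite EFinD; apply: lte_leD => //; exact: fin_num_measure.
Qed.

Lemma probability_ge_markov (R : realType) (d : measure_display)
    (Omega : measurableType d) (P : probability Omega R) (Y : {RV P >-> R})
    (K a : R) :
  (forall w, 0 <= Y w) -> ('E_P[Y] <= K%:E)%E -> 0 < a ->
  (P [set w | (a <= Y w)%R] <= (K / a)%:E)%E.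
Proof.
move=> Y0 EY a0.
have YE : [set w | (a%:E <= `|(Y w)%:E|)%E] = [set w | a <= Y w].
  by apply/seteqP; split => w /=; rewrite lee_fin ger0_norm.
have NY : (@id R \o Num.norm) \o Y = Y.
  by apply/funext => w /=; rewrite ger0_norm.
have := markov Y a0 (@measurable_id _ R setT) (fun r h => h) (fun x y _ _ h => h).
rewrite NY YE => /le_trans/(_ EY).
by rewrite EFinM lee_pdivlMr // muleC.
Qed.

(** * Rates of almost sure convergence *)

(** The Markov inequality bounds the probability of a tail event by lambda
    without strictness; this is the notion of rate it yields. *)
Definition as_weak_rate_to0 (R : realType) (d : measure_display)
    (Omega : measurableType d) (P : probability Omega R)
    (Z : nat -> Omega -> R) (Phi : R -> R -> nat) : Prop :=
  forall lambda eps : R, 0 < lambda -> 0 < eps ->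
    (P (tail_event Z (Phi lambda eps) eps) <= lambda%:E)%E.

Lemma as_rate_to0_weak (R : realType) (d : measure_display)
    (Omega : measurableType d) (P : probability Omega R)
    (Z : nat -> Omega -> R) (Phi : R -> R -> nat) :
  as_rate_to0 P Z Phi -> as_weak_rate_to0 P Z Phi.
Proof. by move=> rZ lambda eps l0 e0; exact/ltW/rZ. Qed.

(** The events of the three summands cover that of [z], each getting a third
    of eps and of lambda.  Only the first rate has to be strict. *)
Lemma as_rate_to0_sum3 (R : realType) (X : normedModType R)
    (d : measure_display) (Omega : measurableType d) (P : probability Omega R)
    (z z1 z2 z3 : nat -> Omega -> X) (Phi1 Phi2 Phi3 : R -> R -> nat) :
  (forall n, borel_rv (z n)) -> (forall n, borel_rv (z1 n)) ->
  (forall n, borel_rv (z2 n)) -> (forall n, borel_rv (z3 n)) ->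
  (forall n w, `|z n w| <= `|z1 n w| + `|z2 n w| + `|z3 n w|) ->
  as_rate_to0 P (fun n w => `|z1 n w|) Phi1 ->
  as_weak_rate_to0 P (fun n w => `|z2 n w|) Phi2 ->
  as_weak_rate_to0 P (fun n w => `|z3 n w|) Phi3 ->
  as_rate_to0 P (fun n w => `|z n w|) (fun lambda eps =>
    maxn (Phi1 (lambda / 3) (eps / 3))
      (maxn (Phi2 (lambda / 3) (eps / 3)) (Phi3 (lambda / 3) (eps / 3)))).
Proof.
move=> mz mz1 mz2 mz3 zle r1 r2 r3 lambda eps l0 e0.
have l30 : 0 < lambda / 3 by lra.
have e30 : 0 < eps / 3 by lra.
have P1 := r1 _ _ l30 e30; have P2 := r2 _ _ l30 e30; have P3 := r3 _ _ l30 e30.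
have mt := @measurable_tail_event R X d Omega.
have -> : lambda%:E = (lambda / 3 + lambda / 3 + lambda / 3)%:E.
  by congr EFin; lra.
have m1 := mt z1 (Phi1 (lambda / 3) (eps / 3)) (eps / 3) mz1.
have m2 := mt z2 (Phi2 (lambda / 3) (eps / 3)) (eps / 3) mz2.
have m3 := mt z3 (Phi3 (lambda / 3) (eps / 3)) (eps / 3) mz3.
have P12 := probability_lt_cover (measurableU _ _ m1 m2) m1 m2 (@subset_refl _ _)
  P1 P2.
apply: (probability_lt_cover _ (measurableU _ _ m1 m2) m3 _ P12 P3).
  exact: mt.
move=> w [n []]; rewrite !geq_max => /and3P[n1 n2 n3] /= zn.
have [z1n|z1n] := leP (eps / 3) `|z1 n w|; first by left; left; exists n.
have [z2n|z2n] := leP (eps / 3) `|z2 n w|; first by left; right; exists n.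
right; exists n; split => //.
by have := zle n w; lra.
Qed.

(** Counting [z1] twice costs a third of eps each time but a share of lambda
    only once, since both copies have the same tail event. *)
Lemma as_rate_to0_sum2 (R : realType) (X : normedModType R)
    (d : measure_display) (Omega : measurableType d) (P : probability Omega R)
    (z z1 z2 : nat -> Omega -> X) (Phi1 Phi2 : R -> R -> nat) :
  (forall n, borel_rv (z n)) -> (forall n, borel_rv (z1 n)) ->
  (forall n, borel_rv (z2 n)) ->
  (forall n w, `|z n w| <= `|z1 n w| + `|z1 n w| + `|z2 n w|) ->
  as_rate_to0 P (fun n w => `|z1 n w|) Phi1 ->
  as_rate_to0 P (fun n w => `|z2 n w|) Phi2 ->
  as_rate_to0 P (fun n w => `|z n w|) (fun lambda eps =>
    maxn (Phi1 (lambda / 2) (eps / 3)) (Phi2 (lambda / 2) (eps / 3))).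
Proof.
move=> mz mz1 mz2 zle r1 r2 lambda eps l0 e0.
have l20 : 0 < lambda / 2 by lra.
have e30 : 0 < eps / 3 by lra.
have mt := @measurable_tail_event R X d Omega.
have -> : lambda%:E = (lambda / 2 + lambda / 2)%:E by congr EFin; lra.
apply: (probability_lt_cover _ (mt z1 _ _ mz1) (mt z2 _ _ mz2) _
  (r1 _ _ l20 e30) (ltW (r2 _ _ l20 e30))); first exact: mt.
move=> w [n []]; rewrite !geq_max => /andP[n1 n2] /= zn.
have [z1n|z1n] := leP (eps / 3) `|z1 n w|; first by left; exists n.
right; exists n; split => //.
by have := zle n w; lra.
Qed.

(** Deterministic coefficients tending to 0 beat a factor that is dominated
    almost surely by one variable of finite mean: the exceptional event
    Y >= K / lambda does not depend on the index, so no union over the indices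
    is paid for. *)
Lemma as_weak_rate_to0_scale (R : realType) (X : normedModType R)
    (d : measure_display) (Omega : measurableType d) (P : probability Omega R)
    (a : nat -> R) (z : nat -> Omega -> X) (Y : {RV P >-> R}) (K : R)
    (rho : R -> nat) :
  (forall n, borel_rv (z n)) -> (forall n, 0 <= a n) -> rate_to0 a rho ->
  (forall w, 0 <= Y w) -> 0 < K -> ('E_P[Y] <= K%:E)%E ->
  (forall n, {ae P, forall w, `|z n w| <= Y w}) ->
  as_weak_rate_to0 P (fun n w => `|a n *: z n w|)
    (fun lambda eps => rho (eps * lambda / K)).
Proof.
move=> mz a0 ra Y0 K0 EY /ae_foralln[N [mN PN0 zY]] lambda eps l0 e0.
have Kl0 : 0 < K / lambda by rewrite divr_gt0.
pose A := [set w | K / lambda <= Y w].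
have mA : measurable A.
  have := @measurable_funPT _ _ _ _ Y measurableT `[(K / lambda), +oo[%classic.
  rewrite setTI => /(_ (measurable_itv _)); congr measurable.
  by apply/seteqP; split => w /=; rewrite in_itv /= andbT.
have -> : lambda%:E = ((K / (K / lambda))%:E + 0%:E)%E.
  by rewrite adde0; congr EFin; rewrite invf_div mulrCA divff ?mulr1 ?gt_eqF.
apply: (@le_trans _ _ (P A + P N)%E); last first.
  by apply: leeD; [exact: probability_ge_markov | rewrite PN0].
apply: le_trans (measureU2 P mA mN).
apply: le_measure; rewrite ?inE.
- by apply: measurable_tail_event => n; exact: borel_rvZ.
- exact: measurableU.
move=> w [n [rn azn]].
have [Nw|Nw] := pselect (N w); [by right | left => /=].
have zYn : `|z n w| <= Y w by apply: contrapT => h; apply: Nw; apply: zY => /(_ n).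
have el0 : 0 < eps * lambda / K by rewrite divr_gt0 ?mulr_gt0.
have an := ra _ el0 _ rn.
rewrite normrZ (ger0_norm (a0 n)) in azn.
have /(le_trans azn) : a n * `|z n w| <= eps * lambda / K * Y w.
  by apply: ler_pM => //; exact: ltW.
rewrite -!mulrA ler_pMr // => h; rewrite /A /= ler_pdivrMr //.
have -> : Y w * lambda = K * (lambda * (K^-1 * Y w)) by field; rewrite gt_eqF.
by apply: ler_peMr => //; exact: ltW.
Qed.

(** * Stochastic Halpern-Mann iteration *)

Theorem theorem3p5 (R : realType)
  (d : measure_display) (Omega : measurableType d) (P : probability Omega R)
  (X : normedModType R) (X_separable : separable_space X)
  (T U : X -> X) (T_nonexp : nonexpansive T) (U_nonexp : nonexpansive U)
  (x0 u : Omega -> X) (x0_rv : borel_rv x0) (u_rv : borel_rv u)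
  (xi delta : nat -> Omega -> X)
  (xi_rv : forall n, borel_rv (xi n)) (delta_rv : forall n, borel_rv (delta n))
  (alpha beta : nat -> R)
  (alpha01 : forall n, 0 <= alpha n <= 1) (beta01 : forall n, 0 <= beta n <= 1)
  (x y : nat -> Omega -> X)
  (x_init : forall w, x 0%N w = x0 w)
  (y_def : forall n w,
     y n w = (1 - alpha n) *: (T (x n w) + xi n w) + alpha n *: u w)
  (x_succ : forall n w,
     x n.+1 w = (1 - beta n) *: (U (y n w) + delta n w) + beta n *: y n w)
  (Y : {RV P >-> R}) (Y_ge0 : forall w, 0 <= Y w)
  (K0 : nat) (K0_gt0 : (0 < K0)%N) (EY_le : ('E_P[Y] <= K0%:R%:E)%E)
  (Y_bound : forall n, {ae P, forall w,
     [/\ `|T (x n w) - u w| <= Y w,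
         `|U (y n w) - y n w| <= Y w,
         `|U (u w) - u w| <= Y w
       & `|U (y n w) - u w| <= Y w]})
  (psi : R -> R -> nat)
  (Uy_rate : as_rate_to0 P (fun n w => `|U (y n w) - y n w|) psi)
  (rho : R -> nat) (alpha_rate : rate_to0 alpha rho)
  (phi1 phi2 : R -> R -> nat)
  (xi_rate : as_rate_to0 P (fun n w => `|xi n w|) phi1)
  (delta_rate : as_rate_to0 P (fun n w => `|delta n w|) phi2)
  (psi0 : R -> R -> nat)
  (x_rate : as_rate_to0 P (fun n w => `|x n.+1 w - x n w|) psi0) :
  let psi1 := fun lambda eps : R =>
    maxn (psi0 (lambda / 3) (eps / 3))
      (maxn (psi (lambda / 3) (eps / 3)) (phi2 (lambda / 3) (eps / 3))) in
  let psi2 := fun lambda eps : R =>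
    maxn (psi1 (lambda / 3) (eps / 3))
      (maxn (rho (eps * lambda / (9 * K0%:R))) (phi1 (lambda / 3) (eps / 3))) in
  let psi3 := fun lambda eps : R =>
    maxn (psi1 (lambda / 2) (eps / 3)) (psi (lambda / 2) (eps / 3)) in
  let psi4 := fun lambda eps : R =>
    maxn (psi1 (lambda / 2) (eps / 3)) (psi2 (lambda / 2) (eps / 3)) in
  [/\ as_rate_to0 P (fun n w => `|x n w - y n w|) psi1,
      as_rate_to0 P (fun n w => `|T (y n w) - y n w|) psi2,
      as_rate_to0 P (fun n w => `|U (x n w) - x n w|) psi3
    & as_rate_to0 P (fun n w => `|T (x n w) - x n w|) psi4].
Proof.
move=> psi1 psi2 psi3 psi4.
have K_gt0 : 0 < K0%:R :> R by rewrite ltr0n.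
have cT := nonexpansive_continuous T_nonexp.
have cU := nonexpansive_continuous U_nonexp.
have my_of n : borel_rv (x n) -> borel_rv (y n).
  move=> mx; rewrite (funext (y_def n)).
  apply: (borel_rvD X_separable); apply: borel_rvZ => //.
  by apply: (borel_rvD X_separable) => //; exact: borel_rv_comp.
have mx n : borel_rv (x n).
  elim: n => [|n IHn]; first by rewrite (funext x_init).
  rewrite (funext (x_succ n)).
  apply: (borel_rvD X_separable); apply: borel_rvZ; last exact: my_of.
  by apply: (borel_rvD X_separable) => //; apply: borel_rv_comp => //; exact: my_of.
have my n : borel_rv (y n) by exact: my_of.
have mB (f g : Omega -> X) :
    borel_rv f -> borel_rv g -> borel_rv (fun w => f w - g w).
  exact: borel_rvB.
have mTx n : borel_rv (fun w => T (x n w)) by exact: borel_rv_comp.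
have mTy n : borel_rv (fun w => T (y n w)) by exact: borel_rv_comp.
have mUx n : borel_rv (fun w => U (x n w)) by exact: borel_rv_comp.
have mUy n : borel_rv (fun w => U (y n w)) by exact: borel_rv_comp.
have a : as_rate_to0 P (fun n w => `|x n w - y n w|) psi1.
  apply: (as_rate_to0_sum3 _ _ _ delta_rv _ x_rate (as_rate_to0_weak Uy_rate)
    (as_rate_to0_weak delta_rate)) => n; try exact: mB.
  move=> w; have /andP[b0 b1] := beta01 n.
  have xy : x n.+1 w - y n w =
      (1 - beta n) *: (U (y n w) - y n w + delta n w).
    rewrite x_succ (addrAC (U _)) scalerBr -addrA; congr (_ + _).
    by rewrite scalerBl scale1r opprB.
  have nxy : `|x n.+1 w - y n w| <= `|U (y n w) - y n w| + `|delta n w|.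
    rewrite xy normrZ ger0_norm ?subr_ge0 //.
    by apply: le_trans (ler_normD _ _); apply: ler_piMl => //; lra.
  have := ler_distD (x n.+1 w) (x n w) (y n w).
  by rewrite (distrC (x n w) (x n.+1 w)); lra.
have b : as_rate_to0 P (fun n w => `|T (y n w) - y n w|) psi2.
  have za : as_weak_rate_to0 P (fun n w => `|alpha n *: (T (x n w) - u w)|)
      (fun lambda eps => rho (eps * lambda / K0%:R)).
    apply: (as_weak_rate_to0_scale _ _ alpha_rate Y_ge0 K_gt0 EY_le) => n.
    - exact: mB.
    - by have /andP[] := alpha01 n.
    - by apply: filterS (Y_bound n) => w [].
  (* The thirds of eps and of lambda allotted to the anchor term make up the
     factor 9 in the argument of rho. *)
  have -> : psi2 = fun lambda eps => maxn (psi1 (lambda / 3) (eps / 3))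
      (maxn (rho (eps / 3 * (lambda / 3) / K0%:R)) (phi1 (lambda / 3) (eps / 3))).
    apply/funext => lambda; apply/funext => eps; congr maxn; congr maxn; congr rho.
    by field; rewrite gt_eqF.
  apply: (as_rate_to0_sum3 _ _ _ xi_rv _ a za (as_rate_to0_weak xi_rate)) => n.
  - exact: mB.
  - exact: mB.
  - by apply: borel_rvZ; exact: mB.
  move=> w; have /andP[a0 a1] := alpha01 n.
  have Txy : T (x n w) - y n w =
      alpha n *: (T (x n w) - u w) - (1 - alpha n) *: xi n w.
    have aT : (1 - alpha n) *: T (x n w) = T (x n w) - alpha n *: T (x n w).
      by rewrite scalerBl scale1r.
    rewrite y_def scalerDr aT scalerBr !opprD opprK !addrA subrr add0r.
    exact: addrAC.
  have nTxy : `|T (x n w) - y n w| <=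
      `|alpha n *: (T (x n w) - u w)| + `|xi n w|.
    rewrite Txy; apply: le_trans (ler_normB _ _) _; rewrite lerD2l.
    by rewrite normrZ ger0_norm ?subr_ge0 //; apply: ler_piMl => //; lra.
  have := ler_distD (T (x n w)) (T (y n w)) (y n w).
  by have := T_nonexp (y n w) (x n w); rewrite (distrC (y n w) (x n w)); lra.
have res (V : X -> X) (nV : nonexpansive V) n w :
    `|V (x n w) - x n w| <=
    `|x n w - y n w| + `|x n w - y n w| + `|V (y n w) - y n w|.
  have := ler_distD (V (y n w)) (V (x n w)) (x n w).
  have := ler_distD (y n w) (V (y n w)) (x n w).
  by have := nV (x n w) (y n w); rewrite (distrC (y n w) (x n w)); lra.
split=> //.
- by apply: (as_rate_to0_sum2 _ _ _ (res U U_nonexp) a Uy_rate) => n; exact: mB.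
- by apply: (as_rate_to0_sum2 _ _ _ (res T T_nonexp) a b) => n; exact: mB.
Qed.
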